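(* Let $S,K$ be fixed and let $\mathcal Q$ be the parameter space of pairs $(\Omega,B)$ defined in the context. Suppose $(\Omega^*,B^* )\in\mathcal Q$ with $\|\Omega^*\|_0=S$ and $\operatorname{rank}(L^* )=K$, where $L^*=(I_p-B^* )^\top\Omega^*(I_p-B^* )-\Omega^*$. Then there exists $\epsilon>0$ such that for any $(\Omega,B)\in\mathcal Q$ satisfying $\|\Omega-\Omega^*\|_{\max}<\epsilon$ and $\|B-B^*\|_{\max}<\epsilon$, if $$(I_p-B)^\top\Omega(I_p-B)=(I_p-B^* )^\top\Omega^*(I_p-B^* ),$$ then $(\Omega,B)=(\Omega^*,B^* )$.
   Context: Fix $p\ge1$. For a matrix $A$, $\|A\|_{\max}=\max_{ij}|a_{ij}|$ and $\|A\|_0$ is the number of nonzero entries; $\succ0$ means symmetric positive definite. For real $p\times p$ matrices $\Omega$ (symmetric) and $B$, put $L=(I_p-B)^\top\Omega(I_p-B)-\Omega=B^\top\Omega B-B^\top\Omega-\Omega B$, a symmetric matrix. CG-feasibility: $(\Omega,B)$ is CG-feasible if there is a permutation matrix $P$ such that $P\Omega P^\top$ and $PBP^\top$ share the same block structure (same partition of $\{1,\dots,p\}$ into consecutive blocks), with $P\Omega P^\top$ block diagonal and $PBP^\top$ block lower triangular with zero diagonal blocks. Tangent spaces: $\mathcal S(\Omega)=\{M\in\mathbb R^{p\times p}: M^\top=M,\ m_{ij}=0 \text{ whenever } \omega_{ij}=0\}$. If $L=U_1D_1U_1^\top$ is the eigendecomposition of $L$ with $U_1^\top U_1=I_r$,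 $r=\operatorname{rank}(L)$ and $D_1$ an invertible $r\times r$ diagonal matrix, then $\mathcal T(L)=\{U_1Y+Y^\top U_1^\top: Y\in\mathbb R^{r\times p}\}$. The parameter space $\mathcal Q$ (depending on $S,K$) is the set of CG-feasible $(\Omega,B)$ such that: $\Omega\succ0$; $\Omega+L\succ0$; $\|\Omega\|_0\le S$; $\operatorname{rank}(L)\le K$; (Assumption 1) $\mathcal S(\Omega)\cap\mathcal T(L)=\{0\}$; (Assumption 2) the nonzero eigenvalues of $L$ (the diagonal entries of $D_1$) are pairwise distinct. *)

(* Defs.v *)
From HB Require Import structures.
From mathcomp Require Import all_boot all_order all_algebra all_fingroup.
From mathcomp Require Import boolp classical_sets reals normedtype.

Set Implicit Arguments.
Unset Strict Implicit.
Unset Printing Implicit Defensive.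

Import Order.TTheory GRing.Theory Num.Theory.
Local Open Scope ring_scope.

Section Definitions.
Context {R : realType} {p : nat}.
Implicit Types (Omega B L M : 'M[R]_p) (Pi : {set {set 'I_p}}).

Definition nnz M : nat := #|[pred ij : 'I_p * 'I_p | M ij.1 ij.2 != 0]|.

Definition posdefmx M : Prop :=
  M^T = M /\ forall x : 'cV[R]_p, x != 0 -> 0 < (x^T *m M *m x) 0 0.

Definition Lmx Omega B : 'M[R]_p :=
  (1%:M - B)^T *m Omega *m (1%:M - B) - Omega.

Definition consecutive_partition Pi : Prop :=
  finset.partition Pi [set: 'I_p]%SET /\
  forall A, A \in Pi -> forall i j k : 'I_p,
    i \in A -> k \in A -> (i <= j <= k)%N -> j \in A.

Definition block_diag Pi M : Prop :=
  forall i j : 'I_p, finset.pblock Pi i != finset.pblock Pi j -> M i j = 0.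

(* For a partition into consecutive blocks, an entry (i, j) whose indices are
   in different blocks lies strictly above the block diagonal iff i < j. *)
Definition block_lower_triangular Pi M : Prop :=
  forall i j : 'I_p, finset.pblock Pi i != finset.pblock Pi j -> (i < j)%N -> M i j = 0.

Definition zero_diag_blocks Pi M : Prop :=
  forall i j : 'I_p, finset.pblock Pi i = finset.pblock Pi j -> M i j = 0.

Definition CG_feasible Omega B : Prop :=
  exists (P : 'M[R]_p) (Pi : {set {set 'I_p}}),
    [/\ is_perm_mx P,
        consecutive_partition Pi,
        block_diag Pi (P *m Omega *m P^T),
        block_lower_triangular Pi (P *m B *m P^T) &
        zero_diag_blocks Pi (P *m B *m P^T)].

Definition tangent_sparse Omega : set 'M[R]_p :=
  [set M | M^T = M /\ forall i j, Omega i j = 0 -> M i j = 0]%classic.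

Definition eigendecomposition L
    (U1 : 'M[R]_(p, \rank L)) (D1 : 'M[R]_(\rank L)) : Prop :=
  [/\ U1^T *m U1 = 1%:M, is_diag_mx D1, D1 \in unitmx &
      L = U1 *m D1 *m U1^T].

(* The tangent space does not depend on the choice of the decomposition; see
   tangent_lowrankE. *)
Definition tangent_lowrank L : set 'M[R]_p :=
  [set M | exists U1 D1, @eigendecomposition L U1 D1 /\
     exists Y : 'M[R]_(\rank L, p), M = U1 *m Y + Y^T *m U1^T]%classic.

Definition distinct_nonzero_eigenvalues L : Prop :=
  exists U1 D1, @eigendecomposition L U1 D1 /\ injective (fun k => D1 k k).

Lemma tangent_lowrankE L U1 D1 : @eigendecomposition L U1 D1 ->
  tangent_lowrank L =
  [set M | exists Y : 'M[R]_(\rank L, p), M = U1 *m Y + Y^T *m U1^T]%classic.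
Proof.
move=> dL; apply/seteqP; split=> M /=; last by exists U1, D1.
case=> V [E [[VV _ Eu LV] [Y ->]]]; case: dL => _ _ _ LU.
pose Z := D1 *m U1^T *m V *m invmx E.
have LV_ : L *m V = V *m E.
  by transitivity (V *m E *m V^T *m V); [rewrite -LV|rewrite -mulmxA VV mulmx1].
have VE : V = U1 *m Z by rewrite /Z !mulmxA -LU LV_ mulmxK.
by exists (Z *m Y); rewrite {1 2}VE !trmx_mul !mulmxA.
Qed.

Record param_space (S K : nat) Omega B : Prop := ParamSpace {
  ps_feasible : CG_feasible Omega B;
  ps_posdef : posdefmx Omega;
  ps_posdef_sum : posdefmx (Omega + Lmx Omega B);
  ps_sparse : (nnz Omega <= S)%N;
  ps_lowrank : (\rank (Lmx Omega B) <= K)%N;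
  ps_transversal :
    (tangent_sparse Omega `&` tangent_lowrank (Lmx Omega B) = [set 0])%classic;
  ps_distinct : distinct_nonzero_eigenvalues (Lmx Omega B)
}.

End Definitions.

(* Main.v *)
(** Write a star as 0 and put M = Omega0 - Omega, so that L = L0 + M.  Near
    Omega0, the sparsity bound forces Omega to have the support of Omega0, hence M
    lies in S(Omega0).  With Q the orthogonal projector onto ker L0, the rank bound
    makes Q M Q of order |M|^2, whereas T(L0) consists of the symmetric matrices
    with Q M Q = 0, so by transversality M |-> Q M Q is injective, hence bounded
    below, on S(Omega0).  Thus M = 0 when M is small.  Near B0, the support of B
    contains that of B0, so the block ordering of B is also one for B0, and a block
    Cholesky factorisation with given ordering and diagonal part is unique. *)

Require Import Defs.
From mathcomp Require Import classical_sets.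
From HB Require Import structures.
From mathcomp Require Import all_boot all_order all_algebra all_fingroup.
From mathcomp Require Import zify lra.
From mathcomp Require Import reals normedtype.

Set Implicit Arguments.
Unset Strict Implicit.
Unset Printing Implicit Defensive.

Import Order.TTheory GRing.Theory Num.Theory.
Local Open Scope ring_scope.

(** * Max-norm bounds for matrices and linear maps *)

Lemma mx_norm_le (R : realType) (m n : nat) (A : 'M[R]_(m, n)) (c : R) :
  0 <= c -> (forall i j, `|A i j| <= c) -> `|A| <= c.
Proof.
by move=> c0 Ac; rewrite /Num.norm /= mx_normrE; apply: bigmax_le => // -[i j] _.
Qed.

Lemma mx_entry_le_norm (R : realType) (m n : nat) (A : 'M[R]_(m, n)) i j :
  `|A i j| <= `|A|.
Proof.
rewrite [leRHS]/Num.norm /= mx_normrE.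
exact: (le_bigmax _ (fun ij : 'I_m * 'I_n => `|A ij.1 ij.2|) (i, j)).
Qed.

Lemma mx_norm_mul (R : realType) (m n q : nat)
    (A : 'M[R]_(m, n)) (B : 'M[R]_(n, q)) :
  `|A *m B| <= n%:R * `|A| * `|B|.
Proof.
apply: mx_norm_le => [|i j]; first by rewrite !mulr_ge0.
rewrite mxE (le_trans (ler_norm_sum _ _ _)) //.
rewrite -mulrA mulr_natl -[X in _ *+ X]card_ord -sumr_const.
by apply: ler_sum => k _; rewrite normrM ler_pM ?mx_entry_le_norm.
Qed.

Lemma linear_mx_bounded (R : realType) (m n m' n' : nat)
    (f : {linear 'M[R]_(m, n) -> 'M[R]_(m', n')}) :
  exists2 C : R, 0 < C & forall M, `|f M| <= C * `|M|.
Proof.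
(* The norms of the images of the basis matrices, with 1 added to keep the constant positive. *)
exists (1 + \sum_i \sum_j `|f (delta_mx i j)|) => [|M].
  by rewrite ltr_pwDl // sumr_ge0 // => i _; rewrite sumr_ge0.
rewrite mulrDl mul1r ler_wpDl // {1}[M]matrix_sum_delta linear_sum.
rewrite (le_trans (ler_norm_sum _ _ _)) // mulr_suml; apply: ler_sum => i _.
rewrite linear_sum (le_trans (ler_norm_sum _ _ _)) // mulr_suml.
apply: ler_sum => j _.
by rewrite linearZ mx_normZ mulrC ler_wpM2l ?mx_entry_le_norm.
Qed.

(** The joint map [M |-> (f M, g M)] is injective, so it has a linear left inverse, which is
    bounded; on the kernel of [g] this inverse only sees [f M]. *)
Lemma linear_mx_injective_bound (R : realType) (m n m1 n1 m2 n2 : nat)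
    (f : {linear 'M[R]_(m, n) -> 'M[R]_(m1, n1)})
    (g : {linear 'M[R]_(m, n) -> 'M[R]_(m2, n2)}) :
  (forall M, g M = 0 -> f M = 0 -> M = 0) ->
  exists2 C : R, 0 < C & forall M, g M = 0 -> `|M| <= C * `|f M|.
Proof.
move=> inj; pose G := row_mx (lin_mx f) (lin_mx g).
have freeG : row_free G.
  apply: inj_row_free => v; rewrite mul_mx_row -[0]row_mx0.
  case/eq_row_mx; rewrite !mul_rV_lin => fv gv.
  rewrite -[v]vec_mxK (inj (vec_mx v)) ?linear0 //.
    by apply: (can_inj mxvecK); rewrite gv linear0.
  by apply: (can_inj mxvecK); rewrite fv linear0.
pose H := usubmx (pinvmx G).
have [C C0 bC] := linear_mx_bounded (vec_mx \o mulmxr H \o mxvec : 'M_(m1, n1) -> 'M_(m, n)).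
exists C => // M gM; rewrite -{1}[M]mxvecK -(mulmxKp freeG (mxvec M)).
rewrite mul_mx_row !mul_vec_lin gM linear0 -[pinvmx G]vsubmxK mul_row_col mul0mx.
by rewrite addr0; apply: bC.
Qed.

(** * Perturbation under a rank bound *)

(* Schur complement: when [D + U^T M U] is invertible, the rank bound forces
   [Q M Q = Q M U (D + U^T M U)^-1 U^T M Q], where [Q = 1 - U U^T]. *)
Lemma lowrank_perturbation (R : realType) (p r : nat)
    (U : 'M[R]_(p, r)) (D : 'M[R]_r) :
  U^T *m U = 1%:M -> D \in unitmx ->
  exists C delta : R, [/\ 0 < C, 0 < delta & forall M : 'M[R]_p,
    `|M| < delta -> (\rank (U *m D *m U^T + M)%R <= r)%N ->
    `|(1%:M - U *m U^T) *m M *m (1%:M - U *m U^T)| <= C * `|M| ^+ 2].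
Proof.
move=> UU uD; set Q := 1%:M - U *m U^T.
have QU : Q *m U = 0 by rewrite mulmxBl mul1mx -mulmxA UU mulmx1 subrr.
have UQ : U^T *m Q = 0 by rewrite mulmxBr mulmx1 mulmxA UU mul1mx subrr.
have [a a0 ba] := linear_mx_bounded
  (mulmx (invmx D) \o mulmxr U \o mulmx U^T : 'M_p -> 'M_r).
have [b b0 bb] := linear_mx_bounded
  (mulmx (invmx D) \o mulmxr Q \o mulmx U^T : 'M_p -> 'M_(r, p)).
have [c c0 bc] := linear_mx_bounded (mulmxr U \o mulmx Q : 'M_p -> 'M_(p, r)).
(* Chosen so that [N] below at least halves norms; [r.+1] in place of [r] keeps [d] positive when
   [r = 0]. *)
pose d : R := (r.+1%:R * a * 2)^-1.
exists (r.+1%:R * c * (2 * b)), d.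
split=> [||M Md rkL]; first by rewrite !mulr_gt0.
  by rewrite invr_gt0 !mulr_gt0.
pose N := invmx D *m (U^T *m M *m U).
have contr q (X : 'M_(r, q)) : `|N *m X| <= `|X| / 2.
  apply: le_trans (mx_norm_mul _ _) _.
  rewrite mulrC ler_wpM2l //.
  have : r%:R * `|N| <= r.+1%:R * (a * d).
    by rewrite ler_pM ?ler_nat // (le_trans (ba M)) // ler_pM2l // ltW.
  move/le_trans; apply; rewrite /d mulrA; set x := r.+1%:R * a.
  have x0 : x != 0 by rewrite gt_eqF // mulr_gt0.
  by rewrite invfM mulrA divff // mul1r.
(* A kernel vector [v] would satisfy [v = - N v], hence have norm at most half its own. *)
have uN : 1%:M + N \in unitmx.
  rewrite -unitmx_tr -row_free_unit; apply: inj_row_free => v.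
  move/(congr1 trmx); rewrite trmx_mul trmxK trmx0 mulmxDl mul1mx => /eqP.
  rewrite addr_eq0 => /eqP vN; apply: trmx_inj; rewrite trmx0; apply/eqP.
  rewrite -normr_le0; have := contr _ v^T; rewrite -normrN -vN; lra.
pose L := U *m D *m U^T + M.
pose A := D *m (1%:M + N).
have uA : A \in unitmx by rewrite unitmx_mul uD.
have AE : U^T *m L *m U = A.
  rewrite /A /N [RHS]mulmxDr mulmx1 mulKVmx // /L mulmxDr mulmxDl.
  by rewrite !mulmxA UU mul1mx -[D *m U^T *m U]mulmxA UU mulmx1.
have QL : Q *m L = Q *m M by rewrite mulmxDr !mulmxA QU !mul0mx add0r.
have LQ : U^T *m L *m Q = U^T *m M *m Q.
  by rewrite [U^T *m L]mulmxDr mulmxDl -!mulmxA UQ !mulmx0 add0r.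
(* Since [U^T L U = A] is invertible, [U^T L] has rank at least [r], so its row space is all of that
   of [L]. *)
have UL_L : (L <= U^T *m L)%MS.
  have s : (U^T *m L <= L)%MS by apply: submxMl.
  rewrite -(mxrank_leqif_sup s) eqn_leq mxrankS //=.
  by apply: (leq_trans rkL); rewrite -{1}(mxrank_unit uA) -AE; exact: mxrankM_maxl.
have [Y LY] := submxP UL_L.
pose Z := invmx A *m (U^T *m M *m Q).
have QMQ : Q *m M *m Q = Q *m M *m U *m Z.
  have -> : Q *m M = Q *m Y *m (U^T *m L) by rewrite -QL {1}LY mulmxA.
  transitivity (Q *m Y *m (A *m Z)); last by rewrite -AE !mulmxA.
  by rewrite -mulmxA LQ mulKVmx.
have ZE : (1%:M + N) *m Z = invmx D *m (U^T *m M *m Q).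
  by rewrite -(mulKmx uD (1%:M + N)) -/A -[LHS]mulmxA (mulKVmx uA).
(* Absorb [N Z], of norm at most half that of [Z], into the left-hand side of [ZE]. *)
have Zb : `|Z| <= 2 * b * `|M|.
  have := bb M; rewrite /= -ZE mulmxDl mul1mx => h1.
  have h2 := contr _ Z.
  have h3 : `|Z| <= `|Z + N *m Z| + `|N *m Z|.
    by rewrite -{1}[Z](addrK (N *m Z)) ler_normB.
  lra.
rewrite QMQ (le_trans (mx_norm_mul _ _)) //.
have -> : r.+1%:R * c * (2 * b) * `|M| ^+ 2 = r.+1%:R * (c * `|M|) * (2 * b * `|M|).
  by rewrite expr2; lra.
by rewrite ler_pM ?mulr_ge0 // ler_pM ?ler_nat //; exact: bc.
Qed.

(** * Supports and block orderings *)

Lemma nonzero_entries_open (R : realType) (m n : nat) (A : 'M[R]_(m, n)) :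
  exists2 delta : R, 0 < delta & forall A' : 'M[R]_(m, n),
    `|A' - A| < delta -> forall i j, A i j != 0 -> A' i j != 0.
Proof.
(* The least modulus of a nonzero entry, or a smaller 1; the default 1 covers [A = 0]. *)
exists (\big[Order.min/1]_(ij | A ij.1 ij.2 != 0) `|A ij.1 ij.2|).
  by apply/bigmin_gtP; split=> // ij; rewrite normr_gt0.
move=> A' /bigmin_gtP[_ small] i j Aij; apply: contraL (small (i, j) Aij) => /= /eqP A'0.
by rewrite -leNgt (le_trans _ (mx_entry_le_norm _ i j)) // !mxE A'0 sub0r normrN.
Qed.

(** A level function on the original indices replaces permutation and partition: each index is
    labelled by the largest element of its block, and consecutive blocks are ordered by these
    labels. *)
Lemma CG_feasible_level (R : realType) (p : nat) (Omega B : 'M[R]_p) :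
  CG_feasible Omega B -> exists f : 'I_p -> nat,
    (forall i j, Omega i j != 0 -> f i = f j) /\
    (forall i j, B i j != 0 -> (f j < f i)%N).
Proof.
case=> P [Pi [/is_perm_mxP[s ->] [Ppart Pcons] bdO bltB zdB]].
have [covP trivP _] := and3P Ppart.
have inb x : x \in pblock Pi x by rewrite mem_pblock (eqP covP) inE.
have Pblock x : pblock Pi x \in Pi by rewrite pblock_mem // (eqP covP) inE.
have conjE (M : 'M[R]_p) i j : (perm_mx s *m M *m (perm_mx s)^T) (s^-1%g i) (s^-1%g j) = M i j.
  by rewrite tr_perm_mx -row_permE -col_permE !mxE !permKV.
pose top x := \max_(k in pblock Pi x) k.
exists (fun i => top (s^-1%g i)); split=> i j; rewrite -conjE.
  move=> nz; suff e : pblock Pi (s^-1%g i) = pblock Pi (s^-1%g j) by rewrite /top e.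
  by apply/eqP; apply: contraNT nz => /bdO ->.
move: (s^-1%g i) (s^-1%g j) => x y nz.
have xy : pblock Pi x != pblock Pi y by apply: contraNneq nz => /zdB ->.
have yx : (y <= x)%N by rewrite leqNgt; apply: contraNN nz => /(bltB _ _ xy) ->.
rewrite ltnNge; apply: contraNN xy => le_xy.
(* Otherwise [x] lies between [y] and the largest element [k] of the block of [y], hence in that
   block. *)
have [k ky topk] : {k | k \in pblock Pi y & top y = k}.
  by apply: eq_bigmax_cond; apply/card_gt0P; exists y.
have xk : (x <= k)%N.
  by rewrite -topk (leq_trans _ le_xy) // /top (bigop.bigmax_sup x).
apply/eqP/same_pblock => //; apply: (Pcons _ (Pblock y) y x k) => //.
by rewrite yx.
Qed.

(** * Uniqueness of the block triangular factor *)

Lemma posdefmx_mulmx_eq0 (R : realType) (p q : nat) (Omega : 'M[R]_p) (E : 'M[R]_(p, q)) :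
  posdefmx Omega -> Omega *m E = 0 -> E = 0.
Proof.
move=> [_ pos] OE; apply/matrixP => i j.
have [Ej0|Ej] := eqVneq (col j E) 0; first by have /colP/(_ i) := Ej0; rewrite !mxE.
have OEj : Omega *m col j E = 0 by rewrite colE mulmxA OE mul0mx.
by have := pos _ Ej; rewrite -mulmxA OEj mulmx0 mxE ltxx.
Qed.

Lemma triangular_factor_unique (R : realType) (p : nat)
    (Omega B B' : 'M[R]_p) (f : 'I_p -> nat) :
  posdefmx Omega ->
  (forall i j, Omega i j != 0 -> f i = f j) ->
  (forall i j, B i j != 0 -> (f j < f i)%N) ->
  (forall i j, B' i j != 0 -> (f j < f i)%N) ->
  (1%:M - B)^T *m Omega *m (1%:M - B) = (1%:M - B')^T *m Omega *m (1%:M - B') ->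
  B = B'.
Proof.
move=> Opd Of Bf Bf' eqT; have [Osym _] := Opd.
pose E := B - B'; pose F := Omega *m E.
have Ef i j : E i j != 0 -> (f j < f i)%N.
  rewrite /E !mxE; have [->|/Bf//] := eqVneq (B i j) 0.
  by rewrite sub0r oppr_eq0; exact: Bf'.
(* [Omega] only links indices of equal level, so [F] inherits the strict triangularity of [E]. *)
have Ff i j : F i j != 0 -> (f j < f i)%N.
  rewrite mxE ltnNge; apply: contraNN => le_ij; rewrite big1 // => k _.
  have [->|/Of Oik] := eqVneq (Omega i k) 0; first by rewrite mul0r.
  have [->|/Ef] := eqVneq (E k j) 0; first by rewrite mulr0.
  by rewrite -Oik ltnNge le_ij.
(* [eqT] reads [A^T F + F^T A' = 0] with [A = 1 - B], [A' = 1 - B'], and [F] can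
   be shown to vanish row by row, from the highest level down. *)
have key : F = B^T *m F - F^T *m (1%:M - B').
  have : (1%:M - B)^T *m F + F^T *m (1%:M - B') = 0.
    have FE : F = Omega *m (1%:M - B') - Omega *m (1%:M - B).
      by rewrite -mulmxBr /F /E; congr (_ *m _); apply/matrixP => i j; rewrite !mxE; lra.
    have FT : F^T = (1%:M - B')^T *m Omega - (1%:M - B)^T *m Omega.
      by rewrite FE [LHS]linearB /= !trmx_mul Osym.
    rewrite FT FE [X in X + _]mulmxBr [X in _ + X]mulmxBl !mulmxA eqT.
    by rewrite addrC subrKA subrr.
  rewrite [(1%:M - B)^T]linearB /= trmx1 mulmxBl mul1mx => /eqP.
  by rewrite -addrA addr_eq0 opprD opprK => /eqP.
have F0 n i j : (\max_k f k - f i < n)%N -> F i j = 0.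
  elim: n i j => [//|n IH] i j lt_n.
  have up k l : (f i < f k)%N -> F k l = 0.
    move=> ik; apply: IH; have : (f k <= \max_x f x)%N by exact: bigop.leq_bigmax.
    lia.
  (* By triangularity of [B] and [F], both terms of [key] in row [i] only involve rows of [F] of
     level above [f i], already known to vanish. *)
  have BF0 : (B^T *m F) i j = 0.
    rewrite mxE big1 // => k _; rewrite mxE.
    have [->|/Bf /up ->] := eqVneq (B k i) 0; first by rewrite mul0r.
    by rewrite mulr0.
  have FA0 : (F^T *m (1%:M - B')) i j = 0.
    rewrite mxE big1 // => k _; rewrite [F^T _ _]mxE.
    have [->|Fki] := eqVneq (F k i) 0; first by rewrite mul0r.
    by rewrite up ?mul0r //; exact: Ff.
  by rewrite key mxE [X in _ + X]mxE BF0 FA0 subr0.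
apply/eqP; rewrite -subr_eq0; apply/eqP; apply: (posdefmx_mulmx_eq0 Opd).
by apply/matrixP => i j; rewrite (F0 _ _ _ (leqnn _)) mxE.
Qed.

(** * The two tangent spaces *)

(** Presents the sparse tangent space as the kernel of one linear map, testing vanishing off the
    support and symmetry on it. *)
Definition sparse_defect (R : realType) (p : nat) (Omega M : 'M[R]_p) : 'M[R]_p :=
  \matrix_(i, j) (M i j - (if Omega i j == 0 then 0 else M j i)).

Lemma sparse_defect_is_linear (R : realType) (p : nat) (Omega : 'M[R]_p) :
  linear (sparse_defect Omega).
Proof. by move=> a M N; apply/matrixP => i j; rewrite !mxE; case: eqP => _; lra. Qed.

HB.instance Definition _ (R : realType) (p : nat) (Omega : 'M[R]_p) :=
  GRing.isLinear.Build R 'M[R]_p 'M[R]_p _ (sparse_defect Omega)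
    (sparse_defect_is_linear Omega).

Lemma sparse_defect_eq0 (R : realType) (p : nat) (Omega M : 'M[R]_p) :
  Omega^T = Omega -> sparse_defect Omega M = 0 <-> tangent_sparse Omega M.
Proof.
move=> Osym; split=> [dM|[Msym M0]].
  have dMij i j : M i j = if Omega i j == 0 then 0 else M j i.
    by move/matrixP: dM => /(_ i j); rewrite !mxE => /eqP; rewrite subr_eq0 => /eqP.
  split=> [|i j O0]; last by rewrite dMij O0 eqxx.
  apply/matrixP => i j; rewrite mxE dMij [RHS]dMij dMij.
  have -> : Omega j i = Omega i j by rewrite -{1}Osym mxE.
  by case: eqP.
apply/matrixP => i j; rewrite !mxE; case: eqP => [/M0 ->|_]; first by rewrite subr0.
by rewrite -{1}Msym mxE subrr.
Qed.

Lemma tangent_lowrank_compression (R : realType) (p : nat) (L M : 'M[R]_p) U D :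
  @eigendecomposition R p L U D -> M^T = M ->
  (1%:M - U *m U^T) *m M *m (1%:M - U *m U^T) = 0 -> tangent_lowrank L M.
Proof.
move=> dL Msym; set W := U *m U^T => QMQ.
(* The sum [U Y + Y^T U^T] is then [W M + M W - W M W], which differs from [M] by exactly [Q M Q],
   where [Q = 1 - W]; the half shares out the doubly counted [W M W]. *)
pose Y := U^T *m M - 2^-1 *: (U^T *m M *m W).
exists U, D; split => //; exists Y.
have Wsym : W^T = W by rewrite /W trmx_mul trmxK.
have UY : U *m Y = W *m M - 2^-1 *: (W *m M *m W).
  by rewrite mulmxBr -scalemxAr !mulmxA.
have YU : Y^T *m U^T = M *m W - 2^-1 *: (W *m M *m W).
  have WM : (W *m M)^T = M *m W by rewrite trmx_mul Msym Wsym.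
  rewrite -trmx_mul UY linearB linearZ /= [(W *m M *m W)^T]trmx_mul WM.
  by rewrite Wsym [W *m (M *m W)]mulmxA.
rewrite UY YU; move: QMQ.
rewrite mulmxBl mul1mx mulmxBr mulmx1 mulmxBl => /matrixP QMQ.
by apply/matrixP => i j; have := QMQ i j; rewrite !mxE; lra.
Qed.

(** An extra nonzero entry would make the inclusion of supports proper, against the count. *)
Lemma sparse_support_eq (R : realType) (p : nat) (Omega Omega' : 'M[R]_p) :
  (nnz Omega' <= nnz Omega)%N ->
  (forall i j, Omega i j != 0 -> Omega' i j != 0) ->
  forall i j, Omega i j = 0 -> Omega' i j = 0.
Proof.
move=> le_nnz sub i j O0; apply/eqP; apply: contraTT le_nnz => O'ij.
rewrite -ltnNge; apply: proper_card; apply/properP; split.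
  by apply/subsetP => ij; rewrite !inE; exact: sub.
by exists (i, j); rewrite !inE //= O0 eqxx.
Qed.

Theorem theorem1 (R : realType) (p : nat) (p_ge1 : (1 <= p)%N) (S K : nat)
    (Omegas Bs : 'M[R]_p)
    (Qs : param_space S K Omegas Bs)
    (nnzS : nnz Omegas = S)
    (rankK : \rank (Lmx Omegas Bs) = K) :
  exists eps : R, 0 < eps /\
    forall Omega B : 'M[R]_p,
      param_space S K Omega B ->
      mx_norm (Omega - Omegas) < eps ->
      mx_norm (B - Bs) < eps ->
      (1%:M - B)^T *m Omega *m (1%:M - B) =
        (1%:M - Bs)^T *m Omegas *m (1%:M - Bs) ->
      (Omega, B) = (Omegas, Bs).
Proof.
case: Qs => _ Ospd _ _ _ transv [U [D [dL _]]]; have [Ossym _] := Ospd.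
have [UU _ uD LE] := dL; set Q := 1%:M - U *m U^T.
have [C [d [C0 d0 quad]]] := lowrank_perturbation UU uD.
(* Transversality made quantitative. *)
have [c c0 lin] : exists2 c : R, 0 < c &
    forall M, sparse_defect Omegas M = 0 -> `|M| <= c * `|Q *m M *m Q|.
  apply: (@linear_mx_injective_bound _ _ _ _ _ _ _
    (mulmxr Q \o mulmx Q : 'M_p -> 'M_p) (sparse_defect Omegas : 'M_p -> 'M_p)).
  move=> M /(sparse_defect_eq0 _ Ossym) MS QMQ.
  have MT : tangent_lowrank (Lmx Omegas Bs) M.
    exact: tangent_lowrank_compression dL MS.1 QMQ.
  suff : [set 0]%classic M by [].
  by rewrite -transv.
have [d1 d10 suppO] := nonzero_entries_open Omegas.
have [d2 d20 suppB] := nonzero_entries_open Bs.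
(* [d] validates the quadratic estimate, [(c * C)^-1] makes it contradict [lin] unless [M = 0], and
   [d1], [d2] preserve nonzero entries. *)
exists (Num.min (Num.min d (c * C)^-1) (Num.min d1 d2)); split.
  by rewrite !lt_min d0 d10 d20 invr_gt0 mulr_gt0.
move=> Omega B [feas Opd _ nnzO rkL _ _]; rewrite !lt_min.
move=> /andP[/andP[Md McC] /andP[O1 _]] /andP[_ /andP[_ B2]] eqT.
have sub := suppO _ O1; have [Osym _] := Opd.
have OE : Omega = Omegas.
  pose M := Omegas - Omega.
  have normM : mx_norm (Omega - Omegas) = `|M| by rewrite -normrN opprB.
  have LM : Lmx Omega B = (U *m D *m U^T + M)%R.
    by rewrite -LE /Lmx eqT /M addrA subrK.
  have MS : sparse_defect Omegas M = 0.
    apply/sparse_defect_eq0 => //; split=> [|i j O0].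
      by rewrite linearB /= Osym Ossym.
    rewrite !mxE O0 (sparse_support_eq _ sub O0) ?subr0 //.
    by rewrite nnzS.
  have bM : `|M| <= (c * C) * `|M| * `|M|.
    rewrite -!mulrA -expr2 (le_trans (lin M MS)) // ler_pM2l //.
    by apply: quad; rewrite -?normM // -LM rankK.
  apply/eqP; rewrite eq_sym -subr_eq0 -normr_le0 leNgt; apply/negP => M0.
  move: bM; rewrite -[leLHS]mul1r ler_pM2r // leNgt.
  by rewrite mulrC -ltr_pdivlMr ?mulr_gt0 // div1r -normM McC.
rewrite OE in feas eqT *; congr (_, _).
have [f [Of Bf]] := CG_feasible_level feas.
(* Nonzero entries of [Bs] stay nonzero in [B], so the levels [f] of [B] also order [Bs]. *)
apply: (triangular_factor_unique Ospd Of Bf _ eqT) => i j /(suppB _ B2).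
exact: Bf.
Qed.
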